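(* For all positive integers $n\ge r$, $$p(n,r)\ge\left\lfloor\frac{n}{r}\right\rfloor .$$
   Context: A hypergraph is a pair $(V,E)$ where $V$ is a finite set (of vertices) and $E$ is a family of subsets of $V$ (edges). It is $n$-uniform if every edge has size $n$. A vertex $r$-coloring is a map $V\to\{1,\dots,r\}$; it is called panchromatic if every edge contains a vertex of every one of the $r$ colors. $p(n,r)$ denotes the minimal number of edges of an $n$-uniform hypergraph that has no panchromatic $r$-coloring. A minimum over an empty set of hypergraphs is understood as $+\infty$ (this only matters in the degenerate case $r=1$). *)

(* Defs.v *)
From mathcomp Require Import all_boot all_order all_algebra.
From mathcomp Require Import boolp constructive_ereal.

Set Implicit Arguments.
Unset Strict Implicit.
Unset Printing Implicit Defensive.

Record hypergraph := Hypergraph {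
  vertex : finType;
  edges : {set {set vertex}}
}.

Definition uniform (n : nat) (H : hypergraph) : Prop :=
  forall e, e \in edges H -> #|e| = n.

(* The colors 1, ..., r are represented by the elements of 'I_r. *)
Definition panchromatic (r : nat) (H : hypergraph) (f : vertex H -> 'I_r) :
    Prop :=
  forall e, e \in edges H -> forall c : 'I_r, exists2 v, v \in e & f v = c.

Definition no_panchromatic_coloring (r : nat) (H : hypergraph) : Prop :=
  ~ exists f : vertex H -> 'I_r, panchromatic f.

Definition non_panchromatic_size (n r m : nat) : Prop :=
  exists H : hypergraph,
    [/\ uniform n H, no_panchromatic_coloring r H & #|edges H| = m].

(* The codomain is int extended with infinities: the minimum of the empty set
   is +oo. *)
Definition p (n r : nat) : \bar int :=
  match pselect (exists m, `[< non_panchromatic_size n r m >]) with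
  | left ex => ((ex_minn ex)%:Z)%:E
  | right _ => +oo%E
  end.

(* Main.v *)
Require Import Defs.
From mathcomp Require Import all_boot all_order all_algebra.
From mathcomp Require Import boolp constructive_ereal.

(** A panchromatic [r]-coloring of a hypergraph with [m] edges has to meet
    [m * r] demands, one for each edge [e] and color [c]: some vertex of [e] has
    color [c]. If every edge has at least [m * r] vertices, these demands can be
    met greedily, each by a vertex of its own, because fewer than [m * r]
    vertices are reserved at any time ([greedy_coloring]). An [n]-uniform
    hypergraph with at most [n %/ r] edges thus has a panchromatic coloring, and
    so a hypergraph without one has more than [n %/ r] edges. *)

(** The first demand takes any vertex [v] of its set, and the others are then
    met outside [v]: removing [v] costs each set at most one point, just as the
    number of demands drops by one. *)
Lemma greedy_coloring (I : eqType) (T : finType) (C : Type) (c0 : C)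
    (s : seq I) (A : I -> {set T}) (c : I -> C) :
  (forall i, i \in s -> size s <= #|A i|) ->
  exists f : T -> C, forall i, i \in s -> exists2 v, v \in A i & f v = c i.
Proof.
elim: s A => [|i s IHs] A large; first by exists (fun=> c0).
have /card_gt0P[v vAi] : 0 < #|A i|.
  exact: leq_trans (large i (mem_head i s)).
have [j js|f fP] := IHs (fun j => A j :\ v).
  have := large j; rewrite inE js orbT => /(_ isT) /=.
  rewrite (cardsD1 v (A j)); case: (v \in A j) => //=.
  exact: ltnW.
exists (fun w => if w == v then c i else f w) => j.
rewrite inE => /predU1P[->|js]; first by exists v; rewrite ?eqxx.
have [w /setD1P[wv wAj] fw] := fP j js.
by exists w; rewrite ?(negPf wv).
Qed.

Lemma panchromatic_coloring_exists (r : nat) (H : hypergraph) (hr : 0 < r) :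
  (forall e, e \in edges H -> #|edges H| * r <= #|e|) ->
  exists f : vertex H -> 'I_r, panchromatic f.
Proof.
move=> large.
pose s := [seq (e, c) | e <- enum (edges H), c <- enum 'I_r].
have size_s : size s = #|edges H| * r.
  by rewrite size_allpairs -!cardE card_ord.
have [i|f fP] := @greedy_coloring _ _ _ (Ordinal hr) s fst snd.
  case/allpairsP=> [[e c] /= [eH _ ->]] /=.
  by rewrite size_s large // -mem_enum.
exists f => e eH c; apply: (fP (e, c)).
by apply/allpairsP; exists (e, c); rewrite !mem_enum.
Qed.

Theorem proposition1p8 (n r : nat) (hn : 0 < n) (hr : 0 < r) (hrn : r <= n) :
  (((n %/ r)%:Z)%:E <= p n r)%E.
Proof.
rewrite /p; case: pselect => [ex|_]; last exact: leey.
rewrite lee_fin lez_nat.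
case: ex_minnP => m /asboolP[H [unifH noH <-]] _.
rewrite leqNgt; apply/negP => few; apply: noH.
apply: panchromatic_coloring_exists => // e eH.
rewrite unifH //; apply: leq_trans (leq_trunc_div n r).
by rewrite leq_mul2r (ltnW few) orbT.
Qed.
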